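(* Let $G\leqslant \mathrm{GL}(n,\mathbb C)$ be a finite group, let $\Gamma=G\cap \mathrm{SL}(n,\mathbb C)$, and assume that the normal subgroup $\Gamma$ has a complement in $G$, that is, $H:=G/\Gamma$ is realized as a subgroup $H\leqslant G$ with $\Gamma\cap H=1$ and $\Gamma H=G$. Let $S=\mathbb C[x_1,\dots,x_n]$ with the induced linear $G$-action. Then there are isomorphisms of $\mathbb C$-algebras $$A=S*G\;\cong\;(S*\Gamma)*H\;\cong\;\mathrm{End}_{S^\Gamma*H}(S*H),$$ and $S*H\cong Ae_\Gamma$ as a right module over $S^\Gamma*H\cong e_\Gamma Ae_\Gamma$, where $e_\Gamma=\frac1{|\Gamma|}\sum_{\gamma\in\Gamma}\delta_\gamma\in A$. In particular, if $G=\Gamma$ is contained in $\mathrm{SL}(n,\mathbb C)$, the resulting isomorphism reduces to Auslander's isomorphism $S*G\to\mathrm{End}_{S^G}(S)$, $s\delta_g\mapsto(x\mapsto s\,g(x))$.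
   Context: If a group $G$ acts on a $\mathbb C$-algebra $S$ by algebra automorphisms, the twisted group ring $S*G$ is the free left $S$-module with basis $\{\delta_g\}_{g\in G}$ and multiplication $(s'\delta_{g'})(s\delta_g)=s'g'(s)\delta_{g'g}$. $H$ acts on $S^\Gamma$ since $\Gamma$ is normal. In $(S*\Gamma)*H$ the group $H$ acts on $S*\Gamma$ by $h(s\delta_\gamma)=h(s)\delta_{h\gamma h^{-1}}$. $S*H$ is a right $S^\Gamma*H$-module via the inclusion $S^\Gamma*H\subseteq S*H$, and endomorphisms are those of right modules. *)

(* Defs.v *)
From HB Require Import structures.
From mathcomp Require Import all_boot all_order all_algebra all_fingroup.
From mathcomp Require Import mxrepresentation.
From mathcomp Require Import boolp reals complex mpoly.

Set Implicit Arguments.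
Unset Strict Implicit.
Unset Printing Implicit Defensive.

Import Order.TTheory GRing.Theory Num.Theory.
Local Open Scope ring_scope.

(* Left actions of a finite group by algebra automorphisms; invertibility of
   each [alg_act g] follows from the two action laws. *)
Record algAction (C : comNzRingType) (S : algType C) (gT : finGroupType) :=
  AlgAction {
    alg_act :> gT -> {lrmorphism S -> S};
    alg_act1 : forall s, alg_act 1%g s = s;
    alg_actM : forall g h s, alg_act (g * h)%g s = alg_act g (alg_act h s) }.

Section ResAction.
Variables (C : comNzRingType) (S : algType C) (gT : finGroupType).
Variables (act : algAction S gT) (K : {group gT}).

Definition res_act : algAction S (subg_of K) :=
  @AlgAction C S (subg_of K) (fun k => act (sgval k))
    (alg_act1 act) (fun g h => alg_actM act (sgval g) (sgval h)).

End ResAction.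

(* The twisted group ring S * G: the function a stands for \sum_g (a g) delta_g. *)
Definition tgring (C : comNzRingType) (S : algType C) (gT : finGroupType)
  (act : algAction S gT) := {ffun gT -> S}.

HB.instance Definition _ C S gT act :=
  GRing.Lmodule.copy (@tgring C S gT act) {ffun gT -> S}.

Section TwistedGroupRing.
Variables (C : comNzRingType) (S : algType C) (gT : finGroupType).
Variable act : algAction S gT.
Implicit Types a b c : tgring act.

Definition tdelta (s : S) (g : gT) : tgring act :=
  [ffun k => if k == g then s else 0].

Definition tgr_mul a b : tgring act :=
  \sum_g' \sum_g tdelta (a g' * act g' (b g)) (g' * g)%g.

Lemma tgr_sumE (I : Type) (r : seq I) (P : pred I) (F : I -> tgring act) k :
  (\sum_(i <- r | P i) F i) k = \sum_(i <- r | P i) F i k.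
Proof. exact: (sum_ffunE r P F k). Qed.

Lemma tdelta_sum a : a = \sum_g tdelta (a g) g.
Proof.
apply/ffunP=> k; rewrite tgr_sumE (bigD1 k) //= ffunE eqxx big1 ?addr0 //.
by move=> g /negPf; rewrite ffunE eq_sym => ->.
Qed.

Lemma tgr_mulE a b k : tgr_mul a b k = \sum_g a g * act g (b (g^-1 * k)%g).
Proof.
rewrite tgr_sumE; apply: eq_bigr => g _; rewrite tgr_sumE.
rewrite (bigD1 (g^-1 * k)%g) //= ffunE mulKVg eqxx big1 ?addr0 // => h /negPf.
by rewrite ffunE => ne; case: eqP => // e; rewrite e mulKg eqxx in ne.
Qed.

Lemma tgr_mulA : associative tgr_mul.
Proof.
move=> a b c; apply/ffunP=> k; rewrite !tgr_mulE.
under [RHS]eq_bigr => l _ do rewrite tgr_mulE mulr_suml.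
rewrite [RHS]exchange_big /=; apply: eq_bigr => g _.
rewrite tgr_mulE rmorph_sum mulr_sumr.
rewrite [RHS](reindex_inj (mulgI g)); apply: eq_bigr => h _ /=.
by rewrite mulKg rmorphM alg_actM mulrA invMg mulgA.
Qed.

Lemma tgr_mul1r : left_id (tdelta 1 1) tgr_mul.
Proof.
move=> a; apply/ffunP=> k; rewrite tgr_mulE (bigD1 1%g) //= big1 => [|g /negPf].
  by rewrite ffunE eqxx mul1r alg_act1 invg1 mul1g addr0.
by rewrite ffunE => ->; rewrite mul0r.
Qed.

Lemma tgr_mulr1 : right_id (tdelta 1 1) tgr_mul.
Proof.
move=> a; apply/ffunP=> k; rewrite tgr_mulE (bigD1 k) //= big1 => [|g ne].
  by rewrite ffunE mulVg eqxx rmorph1 mulr1 addr0.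
rewrite ffunE; case: eqP => [e|_]; last by rewrite rmorph0 mulr0.
by case/eqP: ne; rewrite -[RHS]mul1g -(mulgV g) -mulgA e mulg1.
Qed.

Lemma tgr_mulDl : left_distributive tgr_mul +%R.
Proof.
move=> a b c; apply/ffunP=> k; rewrite [RHS]ffunE !tgr_mulE -big_split /=.
by apply: eq_bigr => g _; rewrite ffunE mulrDl.
Qed.

Lemma tgr_mulDr : right_distributive tgr_mul +%R.
Proof.
move=> a b c; apply/ffunP=> k; rewrite [RHS]ffunE !tgr_mulE -big_split /=.
by apply: eq_bigr => g _; rewrite ffunE rmorphD mulrDr.
Qed.

Lemma tgr_1neq0 : tdelta 1 1 != 0.
Proof.
apply/eqP=> /ffunP/(_ 1%g); rewrite !ffunE eqxx => /eqP.
by rewrite oner_eq0.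
Qed.

HB.instance Definition _ := GRing.Zmodule_isNzRing.Build (tgring act)
  tgr_mulA tgr_mul1r tgr_mulr1 tgr_mulDl tgr_mulDr tgr_1neq0.

Lemma tgr_scaleAl (k : C) a b : k *: (a * b) = (k *: a) * b.
Proof.
apply/ffunP=> l; rewrite ffunE !tgr_mulE scaler_sumr.
by apply: eq_bigr => g _; rewrite ffunE scalerAl.
Qed.

HB.instance Definition _ :=
  GRing.Lmodule_isLalgebra.Build C (tgring act) tgr_scaleAl.

Lemma tgr_scaleAr (k : C) a b : k *: (a * b) = a * (k *: b).
Proof.
apply/ffunP=> l; rewrite ffunE !tgr_mulE scaler_sumr.
by apply: eq_bigr => g _; rewrite ffunE linearZ scalerAr.
Qed.

HB.instance Definition _ :=
  GRing.Lalgebra_isAlgebra.Build C (tgring act) tgr_scaleAr.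

Lemma tdeltaM s' g' s g :
  tdelta s' g' * tdelta s g = tdelta (s' * act g' s) (g' * g)%g.
Proof.
apply/ffunP=> k; rewrite tgr_mulE (bigD1 g') //= big1 => [|h /negPf].
  rewrite !ffunE eqxx addr0 -(inj_eq (mulgI g')) mulKVg; case: eqP => // _.
  by rewrite rmorph0 mulr0.
by rewrite ffunE => ->; rewrite mul0r.
Qed.

End TwistedGroupRing.

Arguments tdelta {C S gT} act s g.

Section Invariants.
Variables (C : comNzRingType) (S : algType C) (gT : finGroupType).
Variables (act : algAction S gT) (N : {group gT}).

Definition invariant : {pred S} :=
  fun s => [forall g in N, act g s == s].

Lemma invariantP s : reflect (forall g, g \in N -> act g s = s) (s \in invariant).
Proof. exact: (iffP 'forall_in_eqP). Qed.

Lemma invariant_subalg : GRing.subsemialg_closed invariant.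
Proof.
split.
- by apply/invariantP=> g _; rewrite rmorph1.
- split=> [|s t /invariantP Hs /invariantP Ht]; apply/invariantP=> g Ng.
    by rewrite rmorph0.
  by rewrite rmorphD /= (Hs g Ng) (Ht g Ng).
- by move=> k s /invariantP Hs; apply/invariantP=> g Ng; rewrite linearZ /= (Hs g Ng).
- move=> s t /invariantP Hs /invariantP Ht; apply/invariantP=> g Ng.
  by rewrite rmorphM /= (Hs g Ng) (Ht g Ng).
Qed.

Record invs := Invs { invs_val : S; _ : invs_val \in invariant }.

HB.instance Definition _ := [isSub for invs_val].
HB.instance Definition _ := [Choice of invs by <:].
HB.instance Definition _ :=
  GRing.SubChoice_isSubAlgebra.Build C S invariant invs invariant_subalg.

Definition invs_incl (s : invs) : S := val s.

Lemma invs_incl_is_linear : linear invs_incl.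
Proof. by []. Qed.

Lemma invs_incl_is_monoid : monoid_morphism invs_incl.
Proof. by []. Qed.

HB.instance Definition _ := GRing.isLinear.Build C _ _ _ invs_incl
  invs_incl_is_linear.
HB.instance Definition _ := GRing.isMonoidMorphism.Build _ _ invs_incl
  invs_incl_is_monoid.

End Invariants.


(* An element h of G acts by h(s delta_g) = h(s) delta_(h g h^-1), and acts on
   S^N; both need h to normalize N. *)
Section NormalizerActions.
Variables (C : comNzRingType) (S : algType C) (gT : finGroupType).
Variables (act : algAction S gT) (N H : {group gT}).
Hypothesis nNH : (H \subset 'N(N))%g.

Lemma memJ_sub (h : subg_of H) (g : subg_of N) : (sgval g ^ sgval h)%g \in N.
Proof. by rewrite memJ_norm ?subgP // (subsetP nNH) ?subgP. Qed.

Definition conj_fun (h : subg_of H) (a : tgring (res_act act N)) :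
    tgring (res_act act N) :=
  [ffun g => act (sgval h) (a (subg N (sgval g ^ sgval h)%g))].

Lemma conj_fun_delta h s g :
  conj_fun h (tdelta (res_act act N) s g) =
  tdelta (res_act act N) (act (sgval h) s) (subg N (sgval g ^ (sgval h)^-1)%g).
Proof.
have Hg : (sgval g ^ (sgval h)^-1)%g \in N.
  by rewrite memJ_norm ?subgP // (subsetP nNH) ?groupV ?subgP.
apply/ffunP=> k; rewrite !ffunE.
have -> : (subg N (sgval k ^ sgval h)%g == g) = (k == subg N (sgval g ^ (sgval h)^-1)%g).
  rewrite -!(inj_eq val_inj) /= !subgK ?memJ_sub //.
  by rewrite -(inj_eq (conjg_inj (sgval h)^-1%g)) conjgK.
by case: ifP; rewrite ?rmorph0.
Qed.

Lemma conj_fun_is_linear h : linear (conj_fun h).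
Proof.
by move=> k a b; apply/ffunP=> g; rewrite !ffunE linearP.
Qed.

Lemma conj_fun_is_monoid h : monoid_morphism (conj_fun h).
Proof.
split.
  rewrite conj_fun_delta rmorph1; congr tdelta; apply: val_inj.
  by rewrite /= conj1g subgK.
move=> a b; apply/ffunP=> g; rewrite tgr_mulE ffunE tgr_mulE rmorph_sum /=.
pose c (l : subg_of N) := subg N ((sgval l ^ sgval h)%g).
have c_inj : injective c.
  move=> l m /(congr1 val); rewrite /= !subgK ?memJ_sub // => /conjg_inj.
  exact: val_inj.
rewrite (reindex_inj c_inj); apply: eq_bigr => l _.
rewrite !ffunE rmorphM /=; congr (_ * _); rewrite -!alg_actM.
have -> : (sgval h * sgval (c l) = sgval l * sgval h)%g.
  by rewrite subgK ?memJ_sub // conjgE mulKVg.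
congr (act _ (b _)); apply: val_inj; rewrite /= !subgK ?memJ_sub //.
  by rewrite conjMg conjVg.
by rewrite conjMg conjVg groupM ?groupV ?memJ_sub.
Qed.

Definition conj_lrm h :
    {lrmorphism tgring (res_act act N) -> tgring (res_act act N)} :=
  HB.pack (conj_fun h)
    (GRing.isLinear.Build C _ _ _ (conj_fun h) (conj_fun_is_linear h))
    (GRing.isMonoidMorphism.Build _ _ (conj_fun h) (conj_fun_is_monoid h)).

Lemma conj_fun1 a : conj_fun 1%g a = a.
Proof.
by apply/ffunP=> g; rewrite ffunE /= conjg1 sgvalK alg_act1.
Qed.

Lemma conj_funM h k a : conj_fun (h * k)%g a = conj_fun h (conj_fun k a).
Proof.
apply/ffunP=> g; rewrite !ffunE /= alg_actM subgK ?memJ_sub // conjgM.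
by [].
Qed.

Definition conj_act : algAction (tgring (res_act act N)) (subg_of H) :=
  AlgAction (alg_act := conj_lrm) conj_fun1 conj_funM.

Lemma inv_fun_subproof (h : subg_of H) (s : invs act N) :
  act (sgval h) (val s) \in invariant act N.
Proof.
apply/invariantP=> g Ng; rewrite -alg_actM.
have -> : (g * sgval h = sgval h * (g ^ sgval h)%g)%g by rewrite conjgE mulKVg.
rewrite alg_actM; congr (act _ _); apply: (elimT (invariantP _ _ _) (valP s)).
by rewrite memJ_norm // (subsetP nNH) ?subgP.
Qed.

Definition inv_fun h (s : invs act N) : invs act N := Invs (inv_fun_subproof h s).

Lemma inv_fun_is_linear h : linear (inv_fun h).
Proof. by move=> k s t; apply: val_inj; rewrite /= linearP. Qed.

Lemma inv_fun_is_monoid h : monoid_morphism (inv_fun h).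
Proof.
by split=> [|s t]; apply: val_inj; rewrite /= ?rmorph1 ?rmorphM.
Qed.

HB.instance Definition _ h := GRing.isLinear.Build C _ _ _ (inv_fun h)
  (inv_fun_is_linear h).
HB.instance Definition _ h := GRing.isMonoidMorphism.Build _ _ (inv_fun h)
  (inv_fun_is_monoid h).

Lemma inv_fun1 s : inv_fun 1%g s = s.
Proof. by apply: val_inj; rewrite /= alg_act1. Qed.

Lemma inv_funM h k s : inv_fun (h * k)%g s = inv_fun h (inv_fun k s).
Proof. by apply: val_inj; rewrite /= alg_actM. Qed.

Definition inv_act : algAction (invs act N) (subg_of H) :=
  AlgAction (alg_act := fun h => inv_fun h) inv_fun1 inv_funM.

Definition tgr_incl (a : tgring inv_act) : tgring (res_act act H) :=
  [ffun h => invs_incl (a h)].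

Lemma tgr_incl_is_linear : linear tgr_incl.
Proof. by move=> k a b; apply/ffunP=> h; rewrite !ffunE. Qed.

Lemma tgr_incl_is_monoid : monoid_morphism tgr_incl.
Proof.
split=> [|a b]; apply/ffunP=> h.
  by rewrite !ffunE; case: ifP.
rewrite ffunE !tgr_mulE rmorph_sum; apply: eq_bigr => k _.
by rewrite rmorphM !ffunE.
Qed.

HB.instance Definition _ := GRing.isLinear.Build C _ _ _ tgr_incl
  tgr_incl_is_linear.
HB.instance Definition _ := GRing.isMonoidMorphism.Build _ _ tgr_incl
  tgr_incl_is_monoid.

End NormalizerActions.

Arguments tgr_incl {C S gT} act {N H} nNH a.

(* Right B-modules are left modules over the converse ring B^c; here T is a
   right B-module through t . b = t * iota b. *)
Definition restr (C : comNzRingType) (B T : algType C)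
  (iota : {lrmorphism B -> T}) : Type := T.

Section Restr.
Variables (C : comNzRingType) (B T : algType C) (iota : {lrmorphism B -> T}).

HB.instance Definition _ := GRing.Zmodule.copy (restr iota) T.

Let rscale (b : B^c) (t : restr iota) : restr iota := (t : T) * iota b.

Let rscaleA a b t : rscale a (rscale b t) = rscale (a * b) t.
Proof. by rewrite /rscale rmorphM mulrA. Qed.

Let rscale1 : left_id 1 rscale.
Proof. by move=> t; rewrite /rscale rmorph1 mulr1. Qed.

Let rscaleDr : right_distributive rscale +%R.
Proof. by move=> b t u; apply: mulrDl. Qed.

Let rscaleDl t : {morph rscale^~ t : a b / a + b}.
Proof. by move=> a b; rewrite /rscale rmorphD mulrDr. Qed.

HB.instance Definition _ := GRing.Zmodule_isLmodule.Build B^c (restr iota)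
  rscaleA rscale1 rscaleDr rscaleDl.

Lemma restr_scaleE (b : B^c) (t : restr iota) :
  b *: t = (t : T) * iota b :> T.
Proof. by []. Qed.

End Restr.

(* End_B(M) for a right B-module M. It is a C-algebra under composition, where
   k : C acts on M through the central element k%:A of B. *)
Record rEnd (C : comNzRingType) (B : algType C) (M : lmodType B^c) := REnd {
  rEnd_fun :> M -> M;
  rEnd_subproof : `[< linear rEnd_fun >] }.

Section REnd.
Variables (C : comNzRingType) (B : algType C) (M : lmodType B^c).

HB.instance Definition _ := [isSub for @rEnd_fun C B M].
HB.instance Definition _ := [Choice of rEnd M by <:].

Implicit Types f g : rEnd M.

Lemma rEnd_linear f : linear (f : M -> M).
Proof. exact: asboolW (rEnd_subproof f). Qed.

Lemma rEndP f g : (forall m, f m = g m) -> f = g.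
Proof. by move=> fg; apply: val_inj; apply/funext. Qed.

Lemma rEndD f m n : f (m + n) = f m + f n.
Proof. by have := rEnd_linear f 1 m n; rewrite !scale1r. Qed.

Lemma rEnd0 f : f 0 = 0.
Proof. by apply: (addrI (f 0)); rewrite -rEndD !addr0. Qed.

Lemma rEndZ f b m : f (b *: m) = b *: f m.
Proof. by have := rEnd_linear f b m 0; rewrite rEnd0 !addr0. Qed.

Definition mkREnd (f : M -> M) (Hf : linear f) : rEnd M := REnd (asboolT Hf).

Lemma rEnd_zero_linear : linear ((fun=> 0) : M -> M).
Proof. by move=> b m n; rewrite scaler0 addr0. Qed.

Lemma rEnd_opp_linear f : linear ((fun m => - f m) : M -> M).
Proof. by move=> b m n; rewrite rEndD rEndZ opprD scalerN. Qed.

Lemma rEnd_add_linear f g : linear ((fun m => f m + g m) : M -> M).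
Proof. by move=> b m n; rewrite !rEndD !rEndZ scalerDr addrACA. Qed.

Lemma rEnd_one_linear : linear (id : M -> M).
Proof. by []. Qed.

Lemma rEnd_mul_linear f g : linear ((fun m => f (g m)) : M -> M).
Proof. by move=> b m n; rewrite !rEndD !rEndZ. Qed.

Lemma rEnd_scale_linear (k : C) f : linear ((fun m => (k%:A : B^c) *: f m) : M -> M).
Proof.
move=> b m n; rewrite rEndD rEndZ scalerDr !scalerA.
by have -> : (k%:A : B^c) * b = b * (k%:A : B^c)
  by apply: (etrans (mulr_algr k (b : B))); apply/esym/mulr_algl.
Qed.

Definition rEnd_zero := mkREnd rEnd_zero_linear.
Definition rEnd_opp f := mkREnd (rEnd_opp_linear f).
Definition rEnd_add f g := mkREnd (rEnd_add_linear f g).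
Definition rEnd_one := mkREnd rEnd_one_linear.
Definition rEnd_mul f g := mkREnd (rEnd_mul_linear f g).
Definition rEnd_scale k f := mkREnd (rEnd_scale_linear k f).

Fact rEnd_addA : associative rEnd_add.
Proof. by move=> f g h; apply: rEndP => m; apply: addrA. Qed.
Fact rEnd_addC : commutative rEnd_add.
Proof. by move=> f g; apply: rEndP => m; apply: addrC. Qed.
Fact rEnd_add0 : left_id rEnd_zero rEnd_add.
Proof. by move=> f; apply: rEndP => m; apply: add0r. Qed.
Fact rEnd_addN : left_inverse rEnd_zero rEnd_opp rEnd_add.
Proof. by move=> f; apply: rEndP => m; apply: addNr. Qed.

HB.instance Definition _ := GRing.isZmodule.Build (rEnd M)
  rEnd_addA rEnd_addC rEnd_add0 rEnd_addN.

Fact rEnd_mulA : associative rEnd_mul.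
Proof. by move=> f g h; apply: rEndP. Qed.
Fact rEnd_mul1r : left_id rEnd_one rEnd_mul.
Proof. by move=> f; apply: rEndP. Qed.
Fact rEnd_mulr1 : right_id rEnd_one rEnd_mul.
Proof. by move=> f; apply: rEndP. Qed.
Fact rEnd_mulDl : left_distributive rEnd_mul +%R.
Proof. by move=> f g h; apply: rEndP. Qed.
Fact rEnd_mulDr : right_distributive rEnd_mul +%R.
Proof. by move=> f g h; apply: rEndP => m; apply: rEndD. Qed.

HB.instance Definition _ := GRing.Zmodule_isPzRing.Build (rEnd M)
  rEnd_mulA rEnd_mul1r rEnd_mulr1 rEnd_mulDl rEnd_mulDr.

Fact rEnd_scaleA (k l : C) f : rEnd_scale k (rEnd_scale l f) = rEnd_scale (k * l) f.
Proof.
apply: rEndP => m /=; rewrite scalerA.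
by have -> : (k%:A : B^c) * (l%:A : B^c) = (k * l)%:A
  by apply: (etrans (mulr_algr k (l%:A : B))); apply: scalerA.
Qed.
Fact rEnd_scale1 : left_id 1 rEnd_scale.
Proof.
by move=> f; apply: rEndP => m /=; rewrite [X in X *: _]scale1r; apply: scale1r.
Qed.
Fact rEnd_scaleDr : right_distributive rEnd_scale +%R.
Proof. by move=> k f g; apply: rEndP => m; apply: scalerDr. Qed.
Fact rEnd_scaleDl f : {morph rEnd_scale^~ f : k l / k + l}.
Proof.
move=> k l; apply: rEndP => m /=; rewrite [X in X *: _]scalerDl; apply: scalerDl.
Qed.

HB.instance Definition _ := GRing.Zmodule_isLmodule.Build C (rEnd M)
  rEnd_scaleA rEnd_scale1 rEnd_scaleDr rEnd_scaleDl.

End REnd.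

Section REndRestr.
Variables (C : comNzRingType) (B T : algType C) (iota : {lrmorphism B -> T}).
Notation E := (rEnd (restr iota)).

Fact rEnd_1neq0 : 1 != 0 :> E.
Proof.
by apply/eqP=> /(congr1 (fun f : E => f (1 : T) : T)) /eqP; rewrite oner_eq0.
Qed.

HB.instance Definition _ := GRing.PzSemiRing_isNonZero.Build E rEnd_1neq0.

Fact rEnd_scaleAl (k : C) (f g : E) : k *: (f * g) = (k *: f) * g.
Proof. by apply: rEndP. Qed.

HB.instance Definition _ := GRing.Lmodule_isLalgebra.Build C E rEnd_scaleAl.

Fact rEnd_scaleAr (k : C) (f g : E) : k *: (f * g) = f * (k *: g).
Proof. by apply: rEndP => m; apply/esym/rEndZ. Qed.

HB.instance Definition _ := GRing.Lalgebra_isAlgebra.Build C E rEnd_scaleAr.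

End REndRestr.

(* The corner algebra eAe has unit e, so it is not a subring of A. *)
Record idem_elt (A : nzRingType) := Idempotent {
  idem_val : A;
  idem_mul : idem_val * idem_val = idem_val;
  idem_neq0 : idem_val != 0 }.

Section Corner.
Variables (C : comNzRingType) (A : algType C) (ei : idem_elt A).
Notation e := (idem_val ei).

Definition in_corner : {pred A} := fun x => `[< exists a, x = e * a * e >].
Definition in_lideal : {pred A} := fun x => `[< exists a, x = a * e >].

Lemma in_cornerP x : reflect (exists a, x = e * a * e) (x \in in_corner).
Proof. exact: asboolP. Qed.

Lemma in_lidealP x : reflect (exists a, x = a * e) (x \in in_lideal).
Proof. exact: asboolP. Qed.

Lemma in_corner_submod : GRing.subsemimod_closed in_corner.
Proof.
split; first split.
- by apply/in_cornerP; exists 0; rewrite mulr0 mul0r.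
- move=> _ _ /in_cornerP[a ->] /in_cornerP[b ->]; apply/in_cornerP.
  by exists (a + b); rewrite mulrDr mulrDl.
- move=> k _ /in_cornerP[a ->]; apply/in_cornerP.
  by exists (k *: a); rewrite -scalerAr -scalerAl.
Qed.

Lemma in_lideal_zmod : zmod_closed in_lideal.
Proof.
split; first by apply/in_lidealP; exists 0; rewrite mul0r.
move=> _ _ /in_lidealP[a ->] /in_lidealP[b ->]; apply/in_lidealP.
by exists (a - b); rewrite mulrBl.
Qed.

Record corner := Corner { corner_val : A; _ : corner_val \in in_corner }.

HB.instance Definition _ := [isSub for corner_val].
HB.instance Definition _ := [Choice of corner by <:].
HB.instance Definition _ :=
  GRing.SubChoice_isSubLmodule.Build C A in_corner corner in_corner_submod.

Record lideal := Lideal { lideal_val : A; _ : lideal_val \in in_lideal }.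

HB.instance Definition _ := [isSub for lideal_val].
HB.instance Definition _ := [Choice of lideal by <:].
HB.instance Definition _ :=
  GRing.SubChoice_isSubZmodule.Build A in_lideal lideal in_lideal_zmod.

Lemma corner_eK (x : corner) : e * val x = val x.
Proof. by have /in_cornerP[a ->] := valP x; rewrite !mulrA idem_mul. Qed.

Lemma corner_Ke (x : corner) : val x * e = val x.
Proof. by have /in_cornerP[a ->] := valP x; rewrite -!mulrA idem_mul. Qed.

Lemma lideal_Ke (x : lideal) : val x * e = val x.
Proof. by have /in_lidealP[a ->] := valP x; rewrite -mulrA idem_mul. Qed.

Fact corner_one_subproof : e \in in_corner.
Proof. by apply/in_cornerP; exists 1; rewrite mulr1 idem_mul. Qed.

Fact corner_mul_subproof (x y : corner) : val x * val y \in in_corner.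
Proof.
by apply/in_cornerP; exists (val x * val y); rewrite mulrA corner_eK -mulrA corner_Ke.
Qed.

Fact lideal_mul_subproof (x : lideal) (y : corner) : val x * val y \in in_lideal.
Proof. by apply/in_lidealP; exists (val x * val y); rewrite -mulrA corner_Ke. Qed.

Definition corner_one := Corner corner_one_subproof.
Definition corner_mul x y := Corner (corner_mul_subproof x y).

Fact corner_mulA : associative corner_mul.
Proof. by move=> x y z; apply: val_inj; apply: mulrA. Qed.
Fact corner_mul1r : left_id corner_one corner_mul.
Proof. by move=> x; apply: val_inj; apply: corner_eK. Qed.
Fact corner_mulr1 : right_id corner_one corner_mul.
Proof. by move=> x; apply: val_inj; apply: corner_Ke. Qed.
Fact corner_mulDl : left_distributive corner_mul +%R.
Proof. by move=> x y z; apply: val_inj; apply: mulrDl. Qed.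
Fact corner_mulDr : right_distributive corner_mul +%R.
Proof. by move=> x y z; apply: val_inj; apply: mulrDr. Qed.
Fact corner_1neq0 : corner_one != 0.
Proof. by apply/eqP=> /(congr1 val)/eqP; rewrite (negPf (idem_neq0 ei)). Qed.

HB.instance Definition _ := GRing.Zmodule_isNzRing.Build corner
  corner_mulA corner_mul1r corner_mulr1 corner_mulDl corner_mulDr corner_1neq0.

Fact corner_scaleAl (k : C) (x y : corner) : k *: (x * y) = (k *: x) * y.
Proof. by apply: val_inj; apply: scalerAl. Qed.

HB.instance Definition _ := GRing.Lmodule_isLalgebra.Build C corner corner_scaleAl.

Fact corner_scaleAr (k : C) (x y : corner) : k *: (x * y) = x * (k *: y).
Proof. by apply: val_inj; apply: scalerAr. Qed.

HB.instance Definition _ := GRing.Lalgebra_isAlgebra.Build C corner corner_scaleAr.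

Definition lideal_scale (y : corner^c) (x : lideal) : lideal :=
  Lideal (lideal_mul_subproof x y).

Fact lideal_scaleA y z x : lideal_scale y (lideal_scale z x) = lideal_scale (y * z) x.
Proof. by apply: val_inj; apply/esym/mulrA. Qed.
Fact lideal_scale1 : left_id 1 lideal_scale.
Proof. by move=> x; apply: val_inj; apply: lideal_Ke. Qed.
Fact lideal_scaleDr : right_distributive lideal_scale +%R.
Proof. by move=> y x z; apply: val_inj; apply: mulrDl. Qed.
Fact lideal_scaleDl x : {morph lideal_scale^~ x : y z / y + z}.
Proof. by move=> y z; apply: val_inj; apply: mulrDr. Qed.

HB.instance Definition _ := GRing.Zmodule_isLmodule.Build corner^c lideal
  lideal_scaleA lideal_scale1 lideal_scaleDr lideal_scaleDl.

End Corner.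

Section Averaging.
Variables (C : numFieldType) (S : algType C) (gT : finGroupType).
Variables (act : algAction S gT) (N : {group gT}).

Definition avg : tgring act := #|N|%:R^-1 *: \sum_(g in N) tdelta act 1 g.

Lemma avg_idem : avg * avg = avg.
Proof.
rewrite /avg -scalerAl mulr_suml.
rewrite (eq_bigr (fun=> #|N|%:R^-1 *: \sum_(g in N) tdelta act 1 g)).
  rewrite sumr_const -[X in _ *: X]scaler_nat scalerA mulfV ?scale1r //.
  by rewrite pnatr_eq0 -lt0n cardG_gt0.
move=> g Ng; rewrite -scalerAr mulr_sumr; congr (_ *: _).
rewrite [RHS](reindex_inj (mulgI g)) /=; apply: eq_big => h.
  by rewrite groupMl.
by move=> _; rewrite tdeltaM rmorph1 mulr1.
Qed.

Lemma avg_neq0 : avg != 0.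
Proof.
apply/eqP=> avg0; have /eqP := congr1 (fun a => #|N|%:R *: a : tgring act) avg0.
rewrite /avg scaler0 scalerA mulfV ?pnatr_eq0 -?lt0n ?cardG_gt0 // scale1r.
move/eqP/ffunP/(_ 1%g); rewrite tgr_sumE (bigD1 1%g) //= big1.
  by rewrite addr0 !ffunE eqxx => /eqP; rewrite oner_eq0.
by move=> g /andP[_ /negPf ne]; rewrite ffunE eq_sym ne.
Qed.

Definition avg_idempotent := Idempotent avg_idem avg_neq0.

End Averaging.

Section Auslander.
Variables (C : comNzRingType) (S : algType C) (gT : finGroupType).
Variable act : algAction S gT.

Definition invsG : algType C := invs act [set: gT].
Definition inclG : {lrmorphism invsG -> S} := @invs_incl C S gT act [set: gT].
Notation E := (rEnd (restr inclG)).

Lemma auslander_linear (a : tgring act) :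
  linear ((fun x => \sum_g a g * act g x) : restr inclG -> restr inclG).
Proof.
move=> b x y; rewrite !restr_scaleE mulr_suml -big_split; apply: eq_bigr => g _ /=.
rewrite rmorphD mulrDr rmorphM /= !mulrA; congr (_ * _ + _).
by apply: (elimT (invariantP _ _ _) (valP (b : invsG))); rewrite inE.
Qed.

Definition auslander (a : tgring act) : E := mkREnd (auslander_linear a).

Lemma auslander_delta s g (x : S) : auslander (tdelta act s g) x = s * act g x :> S.
Proof.
rewrite /= (bigD1 g) //= ffunE eqxx big1 ?addr0 // => h /negPf.
by rewrite ffunE => ->; rewrite mul0r.
Qed.

Lemma auslander_is_linear : linear auslander.
Proof.
move=> k a b; apply: rEndP => x /=.
rewrite restr_scaleE mulr_suml -big_split; apply: eq_bigr => g _ /=.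
by rewrite !ffunE mulrDl linearZ /= rmorph1 mulr_algr scalerAl.
Qed.

Lemma auslander_is_monoid : monoid_morphism auslander.
Proof.
split=> [|a b]; apply: rEndP => x /=.
  rewrite (bigD1 1%g) //= ffunE eqxx mul1r alg_act1 big1 ?addr0 // => g /negPf.
  by rewrite ffunE => ->; rewrite mul0r.
under eq_bigr => k _ do rewrite tgr_mulE mulr_suml.
rewrite exchange_big /=; apply: eq_bigr => g _; rewrite rmorph_sum mulr_sumr.
rewrite (reindex_inj (mulgI g)); apply: eq_bigr => h _ /=.
by rewrite mulKg alg_actM rmorphM mulrA.
Qed.

HB.instance Definition _ := GRing.isLinear.Build C _ _ _ auslander
  auslander_is_linear.
HB.instance Definition _ := GRing.isMonoidMorphism.Build _ _ auslander
  auslander_is_monoid.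

End Auslander.

Arguments auslander {C S gT} act a.

Section LinearGroup.
Variables (C : fieldType) (gT : finGroupType) (n : nat).
Variable rG : mx_representation C [set: gT] n.

Definition SLpart_set : {set gT} := [set g | \det (rG g) == 1].

Fact SLpart_group_set : group_set SLpart_set.
Proof.
apply/group_setP; split=> [|g h].
  by rewrite inE repr_mx1 det1.
by rewrite !inE => /eqP Hg /eqP Hh; rewrite repr_mxM ?inE // det_mulmx Hg Hh mulr1.
Qed.

Definition SLpart : {group gT} := Group SLpart_group_set.

Lemma SLpart_norm (H : {group gT}) : (H \subset 'N(SLpart))%g.
Proof.
apply/subsetP=> h _; rewrite inE; apply/subsetP=> _ /imsetP[g Hg ->].
move: Hg; rewrite !inE conjgE !repr_mxM ?inE // !det_mulmx => /eqP ->.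
by rewrite mul1r -det_mulmx -repr_mxM ?inE // mulVg repr_mx1 det1.
Qed.

(* g sends the variable x_j to \sum_i g_ij x_i, i.e. x_1, ..., x_n is the
   standard basis of C^n and S = Sym(C^n). *)
Definition lin_subst (g : gT) : n.-tuple {mpoly C[n]} :=
  [tuple \sum_(i < n) rG g i j *: 'X_i | j < n].

Lemma lin_subst1 p : p \mPo lin_subst 1%g = p.
Proof.
rewrite -[RHS]comp_mpoly_id; congr comp_mpoly; apply: eq_mktuple => j.
rewrite repr_mx1 (bigD1 j) //= mxE eqxx scale1r big1 ?addr0 // => i /negPf ne.
by rewrite mxE ne scale0r.
Qed.

Lemma lin_substM g h p :
  p \mPo lin_subst (g * h)%g = (p \mPo lin_subst h) \mPo lin_subst g.
Proof.
rewrite [p]mpolyE [LHS]raddf_sum [X in _ = X \mPo _]raddf_sum [RHS]raddf_sum.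
apply: eq_bigr => m _ /=.
rewrite !linearZ /= !comp_mpolyX rmorph_prod; congr (_ *: _).
apply: eq_bigr => j _ /=; rewrite rmorphXn /= !tnth_mktuple; congr (_ ^+ _).
rewrite raddf_sum /= repr_mxM ?inE //.
under [RHS]eq_bigr => k _ do
  rewrite linearZ /= comp_mpolyXU -tnth_nth tnth_mktuple scaler_sumr.
rewrite exchange_big /=; apply: eq_bigr => i _.
rewrite mxE scaler_suml; apply: eq_bigr => k _.
by rewrite scalerA mulrC.
Qed.

Definition poly_act : algAction {mpoly C[n]} gT :=
  AlgAction (alg_act := fun g => comp_mpoly (lin_subst g)) lin_subst1 lin_substM.

End LinearGroup.

(* Main.v *)
(* As a left A-module, A e_Gamma is S*H, on which s delta_(gamma h) acts by
   t delta_k |-> s (gamma h)(t) delta_(h k). A right S^Gamma*H-endomorphism F of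
   S*H is determined by x |-> F (x delta_1), whose components are, up to a twist
   by H, S^Gamma-linear maps S -> S; this reduces the statement to Auslander's
   theorem for Gamma.
   For that theorem, let f be S^Gamma-linear. Writing tr for the sum over Gamma,
   f (p tr (q x)) = f p tr (q x) lies in the image of S*Gamma as a function of x.
   Summing over suitable pairs (p, q) shows that x |-> f (d x) is in the image
   for each product d = \prod_(g != 1) (g s_g - s_g). An element g != 1 of finite
   order and determinant 1 is not a reflection, so among the linear forms
   g x_j - x_j two are non-proportional, hence coprime; varying s_g between the
   two corresponding variables removes the factors of d one after the other. *)
Require Import Defs.
From HB Require Import structures.
From mathcomp Require Import all_boot all_order all_algebra all_fingroup.
From mathcomp Require Import mxrepresentation.
From mathcomp Require Import boolp reals complex mpoly.

Set Implicit Arguments.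
Unset Strict Implicit.
Unset Printing Implicit Defensive.

Import Order.TTheory GRing.Theory Num.Theory.
Local Open Scope ring_scope.

(** * Auslander's theorem for a domain without reflections *)

(** That is, [l'] is a nonzerodivisor modulo [l]; this form avoids gcds and unique factorization. *)
Definition prime_to (S : comNzRingType) (l l' : S) :=
  forall a b, a * l' = b * l -> exists c, a = c * l.

Section SkewOperators.
Variables (S : idomainType) (gT : finGroupType) (act : gT -> {rmorphism S -> S}).
Hypothesis act1 : forall s, act 1%g s = s.
Hypothesis actM : forall g h s, act (g * h)%g s = act g (act h s).

Implicit Types (f : S -> S) (w : seq (gT * S)).

Definition inv_linear f :=
  (forall x y, f (x + y) = f x + f y) /\
  (forall x c, (forall g, act g c = c) -> f (x * c) = f x * c).

(** Membership of [f] in the image of Auslander's map. *)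
Definition skew_rep f := exists a : gT -> S, forall x, f x = \sum_g a g * act g x.

Lemma inv_linear_sum f (I : Type) (r : seq I) (F : I -> S) :
  inv_linear f -> f (\sum_(i <- r) F i) = \sum_(i <- r) f (F i).
Proof.
move=> [fD _]; have f0 : f 0 = 0 by apply: (addrI (f 0)); rewrite -fD !addr0.
by elim: r => [|i r IH]; rewrite ?big_nil // !big_cons fD IH.
Qed.

Lemma inv_linear_mul f d : inv_linear f -> inv_linear (fun x => f (d * x)).
Proof.
by move=> [fD fM]; split=> [x y|x c invc]; rewrite ?mulrDr // mulrA fM.
Qed.

(* Expand the product of the [act g s (x) 1 - 1 (x) s] in the tensor square of S;
   it vanishes under [p (x) q |-> p * act h q] as soon as h occurs in w. *)
Lemma separating_tensor w : exists t : seq (S * S), forall h,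
  \sum_(p <- t) p.1 * act h p.2 = \prod_(u <- w) (act u.1 u.2 - act h u.2).
Proof.
elim: w => [|[g s] w [t Et]].
  by exists [:: (1, 1)] => h; rewrite big_seq1 big_nil /= rmorph1 mulr1.
exists ([seq (act g s * p.1, p.2) | p <- t] ++ [seq (- p.1, s * p.2) | p <- t]).
move=> h; rewrite big_cons -Et big_cat !big_map mulrBl !mulr_sumr -sumrN /=.
congr (_ + _); apply: eq_bigr => p _; first by rewrite mulrA.
by rewrite rmorphM mulNr mulrCA.
Qed.

Lemma norm_invariant s g : act g (\prod_h act h s) = \prod_h act h s.
Proof.
rewrite rmorph_prod [RHS](reindex_inj (mulgI g)) /=.
by apply: eq_bigr => h _; rewrite actM.
Qed.

(** A separating tensor for all [g != g0], applied to the zero operator with coefficients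
    [a g - b g], isolates the coefficient at [g0] times a nonzero factor, which cancels in a
    domain. *)
Lemma skew_rep_inj (a b : gT -> S) :
  (forall g, g != 1%g -> exists s, act g s != s) ->
  (forall x, \sum_g a g * act g x = \sum_g b g * act g x) -> a =1 b.
Proof.
move=> faith Eab g0; apply/eqP; rewrite -subr_eq0; apply/eqP.
have [s Es] : exists s : gT -> S, forall g, g != g0 -> act g (s g) - act g0 (s g) != 0.
  apply: (@fin_all_exists gT (fun=> S)
    (fun g s => g != g0 -> act g s - act g0 s != 0)) => g.
  have [->|ne] := eqVneq g g0; first by exists 0.
  have [|s sP] := faith (g0^-1 * g)%g.
    by rewrite -(inj_eq (mulgI g0)) mulKVg mulg1.
  exists s => _; apply: contra sP; rewrite subr_eq0 actM => /eqP ->.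
  by rewrite -actM mulVg act1.
have [t Et] := separating_tensor [seq (g, s g) | g <- enum (predC1 g0)].
set d := \prod_(g <- enum (predC1 g0)) (act g (s g) - act g0 (s g)).
have d0 : d != 0.
  rewrite /d prodf_seq_neq0; apply/allP=> g; rewrite mem_enum => ne.
  exact: Es.
apply: (mulIf d0); rewrite mul0r.
have <- : \sum_(p <- t) (\sum_g (a g - b g) * act g p.2) * p.1 = 0.
  apply: big1 => p _; rewrite (_ : \sum_g _ = 0) ?mul0r //.
  by under eq_bigr => ? _ do rewrite mulrBl; rewrite sumrB Eab subrr.
transitivity (\sum_g (a g - b g) * \sum_(p <- t) p.1 * act g p.2).
  rewrite (bigD1 g0) //= [X in _ * _ + X]big1 => [|g ne].
    by rewrite addr0 Et big_map.
  rewrite Et big_map (big_rem g) ?mem_enum //=.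
  by rewrite subrr mul0r mulr0.
under eq_bigr => ? _ do rewrite mulr_sumr.
rewrite exchange_big; apply: eq_bigr => p _; rewrite mulr_suml.
by apply: eq_bigr => g _; rewrite -mulrA [p.1 * _]mulrC.
Qed.

(* [f (p * tr (q * x)) = f p * tr (q * x)] for the trace tr; sum over the pairs
   [(p, q)] of a separating tensor. *)
Lemma skew_rep_mul_discr f w : inv_linear f ->
    (forall g, g != 1%g -> g \in map fst w) ->
  skew_rep (fun x => f (\prod_(u <- w) (act u.1 u.2 - u.2) * x)).
Proof.
move=> linf full; have [t Et] := separating_tensor w.
exists (fun g => \sum_(p <- t) f p.1 * act g p.2) => x.
transitivity (\sum_(p <- t) f (p.1 * \sum_g act g (p.2 * x))).
  rewrite -inv_linear_sum //; congr f.
  under [RHS]eq_bigr => ? _ do rewrite mulr_sumr.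
  rewrite exchange_big (bigD1 1%g) //= [X in _ + X]big1 => [|g ne].
    rewrite addr0 -[X in X * _]/(\prod_(u <- w) _).
    transitivity (\prod_(u <- w) (act u.1 u.2 - act 1%g u.2) * x).
      by congr (_ * _); apply: eq_bigr => u _; rewrite act1.
    by rewrite -Et mulr_suml; apply: eq_bigr => p _; rewrite !act1 mulrA.
  under eq_bigr => ? _ do rewrite rmorphM mulrA.
  rewrite -mulr_suml Et; have /mapP[u uw gu] := full g ne.
  by rewrite (big_rem u) //= gu subrr !mul0r.
under [RHS]eq_bigr => ? _ do rewrite mulr_suml.
rewrite [RHS]exchange_big; apply: eq_bigr => p _.
have [_ fM] := linf; rewrite fM => [|g]; last first.
  rewrite rmorph_sum [RHS](reindex_inj (mulgI g)) /=.
  by apply: eq_bigr => h _; rewrite actM.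
by rewrite mulr_sumr; apply: eq_bigr => g _; rewrite rmorphM mulrA.
Qed.

Hypothesis faithful_act : forall g, g != 1%g -> exists s, act g s != s.

(* Comparing the two representations of [x |-> f (l * l' * x)] shows that [act g l]
   divides the coefficient [a g]; dividing f itself uses that the norm of l is an
   invariant multiple of l. *)
Lemma skew_rep_div f l l' : inv_linear f -> l != 0 -> prime_to l l' ->
  skew_rep (fun x => f (l * x)) -> skew_rep (fun x => f (l' * x)) -> skew_rep f.
Proof.
move=> linf l0 copll [a Ea] [b Eb]; have [_ fM] := linf.
have Eab : (fun g => a g * act g l') =1 (fun g => b g * act g l).
  apply: skew_rep_inj => // x.
  under eq_bigr => ? _ do rewrite -mulrA -rmorphM.
  under [RHS]eq_bigr => ? _ do rewrite -mulrA -rmorphM.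
  by rewrite -Ea -Eb mulrCA.
have [c Ec] : exists c : gT -> S, forall g, a g = c g * act g l.
  apply: (@fin_all_exists gT (fun=> S) (fun g c => a g = c * act g l)) => g.
  have [|c Ec] := copll (act g^-1%g (a g)) (act g^-1%g (b g)).
    have := congr1 (act g^-1%g) (Eab g).
    by rewrite !rmorphM -!actM mulVg !act1.
  exists (act g c); have := congr1 (act g) Ec.
  by rewrite rmorphM -actM mulgV act1.
have Hl x : f (l * x) = \sum_g c g * act g (l * x).
  by rewrite Ea; apply: eq_bigr => g _; rewrite Ec rmorphM mulrA.
exists c => x; pose m := \prod_(h | h != 1%g) act h l.
have Nm : \prod_h act h l = l * m by rewrite (bigD1 1%g) //= act1.
have N0 : \prod_h act h l != 0.
  apply/prodf_neq0 => h _; apply: contra_neq l0 => hl0.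
  by rewrite -(act1 l) -(mulVg h) actM hl0 rmorph0.
apply: (mulIf N0); rewrite -fM; last exact: norm_invariant.
rewrite Nm mulrCA Hl mulr_suml; apply: eq_bigr => g _.
by rewrite mulrCA -Nm rmorphM norm_invariant mulrA.
Qed.

(** Quantifying over all labellings [w] of [r] makes the head factor available with both [s] and
    [s']; [skew_rep_div] then removes it, the rest of the product being absorbed into [f]. *)
Lemma skew_rep_peel (r : seq gT) f : inv_linear f ->
    (forall g, g \in r -> exists s s',
      act g s - s != 0 /\ prime_to (act g s - s) (act g s' - s')) ->
    (forall w, map fst w = r ->
      skew_rep (fun x => f (\prod_(u <- w) (act u.1 u.2 - u.2) * x))) ->
  skew_rep f.
Proof.
elim: r f => [|g r IH] f linf copr rep.
  have [a Ea] := rep [::] erefl.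
  by exists a => x; rewrite -Ea big_nil mul1r.
apply: IH => // [h hr|w Ew]; first by apply: copr; rewrite inE hr orbT.
have [s [s' [s0 cops]]] := copr g (mem_head _ _).
apply: (skew_rep_div (inv_linear_mul _ linf) s0 cops).
  have [|a Ea] := rep ((g, s) :: w); first by rewrite /= Ew.
  by exists a => x; rewrite -Ea big_cons /= mulrCA mulrA.
have [|a Ea] := rep ((g, s') :: w); first by rewrite /= Ew.
by exists a => x; rewrite -Ea big_cons /= mulrCA mulrA.
Qed.

End SkewOperators.

(** Surjectivity of Auslander's map: peel off the factors one by one, starting from a list of all
    nontrivial elements. *)
Lemma inv_linear_skew_rep (S : idomainType) (gT : finGroupType)
    (act : gT -> {rmorphism S -> S}) (f : S -> S) :
    (forall s, act 1%g s = s) ->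
    (forall g h s, act (g * h)%g s = act g (act h s)) ->
    (forall g, g != 1%g -> exists s s',
      act g s - s != 0 /\ prime_to (act g s - s) (act g s' - s')) ->
  inv_linear act f -> skew_rep act f.
Proof.
move=> act1 actM cop linf; apply: (@skew_rep_peel _ _ act _ _ _ (enum (predC1 1%g))) => //.
- by move=> g /cop[s [_ [s0 _]]]; exists s; rewrite -subr_eq0.
- by move=> g; rewrite mem_enum => /cop.
- by move=> w Ew; apply: skew_rep_mul_discr => // g ne; rewrite Ew mem_enum.
Qed.

(** * Linear group actions on polynomials *)

(** Sylvester's identity: a unipotent block matrix intertwines two block triangular matrices with
    these determinants. *)
Lemma det_1Dmul (C : comNzRingType) (m n : nat) (A : 'M[C]_(m, n)) (B : 'M[C]_(n, m)) :
  \det (1%:M + A *m B) = \det (1%:M + B *m A).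
Proof.
have E : block_mx 1%:M 0 B 1%:M *m block_mx (1%:M + A *m B) A 0 1%:M =
         block_mx 1%:M A 0 (1%:M + B *m A) *m block_mx 1%:M 0 B 1%:M.
  rewrite !mulmx_block !mul1mx !mulmx1 ?mul0mx ?mulmx0 ?addr0 ?add0r.
  by rewrite mulmxDl mulmxDr mul1mx mulmx1 mulmxA [B *m A + _]addrC.
have := congr1 determinant E.
by rewrite !det_mulmx !det_lblock !det_ublock !det1 !mulr1 !mul1r.
Qed.

Section LinearForms.
Variables (C : fieldType) (n : nat).
Implicit Types (u v : 'I_n -> C) (p l : {mpoly C[n]}).

Definition linear_form u : {mpoly C[n]} := \sum_i u i *: 'X_i.

Lemma linear_form_coef u i : (linear_form u)@_U_(i) = u i.
Proof.
rewrite raddf_sum (bigD1 i) //= mcoeffZ mcoeffX eqxx mulr1 big1 ?addr0 // => j ne.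
by rewrite mcoeffZ mcoeffX eq_mnm1 (negPf ne) mulr0.
Qed.

(** Congruence modulo the ideal generated by [l] respects the ring operations, so it spreads from
    the variables to all polynomials. *)
Lemma mpoly_comp_congr (t : n.-tuple {mpoly C[n]}) l :
    (forall i, exists q, 'X_i - tnth t i = q * l) ->
  forall p, exists q, p - (p \mPo t) = q * l.
Proof.
move=> ct p; pose R x y := exists q : {mpoly C[n]}, x - y = q * l.
have RM x x' y y' : R x x' -> R y y' -> R (x * y) (x' * y').
  move=> [q Eq] [r Er]; exists (x * r + q * y').
  by rewrite mulrDl -[x * r * l]mulrA -Er [q * y' * l]mulrAC -Eq mulrBr mulrBl addrA subrK.
have R1 : R 1 1 by exists 0; rewrite subrr mul0r.
elim/mpolyind: p => [|c m p _ _ [q Eq]]; first by exists 0; rewrite comp_mpoly0 subrr mul0r.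
have [r Er] : R 'X_[m] ('X_[m] \mPo t).
  rewrite comp_mpolyX mpolyXE_id; apply: big_ind2 => // i _.
  by elim: (m i) => [|k IH]; rewrite ?expr0 // !exprS; apply: RM.
exists (c *: r + q); rewrite comp_mpolyD comp_mpolyZ opprD addrACA Eq -scalerBr Er.
by rewrite mulrDl scalerAl.
Qed.

(* The substitution t eliminating the variable X_i0 kills [linear_form u],
   moves every polynomial by a multiple of it, and does not kill [linear_form v]. *)
Lemma prime_to_linear_form u v i0 j :
  u i0 != 0 -> v j * u i0 != v i0 * u j ->
  prime_to (linear_form u) (linear_form v).
Proof.
move=> u0 vj a b Eab.
pose t := [tuple 'X_i - (if i == i0 then (u i0)^-1 *: linear_form u else 0) | i < n].
have tE w : linear_form w \mPo t = linear_form w - (w i0 / u i0) *: linear_form u.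
  rewrite [LHS]raddf_sum; under eq_bigr => i _ do
    rewrite /= comp_mpolyZ comp_mpolyXU -tnth_nth tnth_mktuple scalerBr.
  rewrite sumrB; congr (_ - _); rewrite (bigD1 i0) //= eqxx scalerA big1 ?addr0 //.
  by move=> i /negPf ->; rewrite scaler0.
have ct i : exists q, 'X_i - tnth t i = q * linear_form u.
  rewrite tnth_mktuple subKr; case: eqP => _; last by exists 0; rewrite mul0r.
  by exists (u i0)^-1%:MP; rewrite mul_mpolyC.
have [q Eq] := mpoly_comp_congr ct a.
have := congr1 (comp_mpoly t) Eab; rewrite !rmorphM /= !tE divff // scale1r subrr mulr0.
move/eqP; rewrite mulf_eq0 => /orP[/eqP a0|/eqP v0].
  by exists q; rewrite -Eq a0 subr0.
have := congr1 (mcoeff U_(j)) v0.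
rewrite mcoeffB mcoeffZ !linear_form_coef mcoeff0 => /eqP.
rewrite subr_eq0 => /eqP vE; case/eqP: vj; rewrite vE mulrAC -[_ * u i0]mulrA.
by rewrite mulVf // mulr1.
Qed.

End LinearForms.

(** * Nontrivial matrices of finite order and determinant 1 are not reflections *)

Section NoReflections.
Variables (C : numFieldType) (gT : finGroupType) (n : nat).
Variable rG : mx_representation C [set: gT] n.

(** The second inequality is a nonzero 2x2 minor of [N]. If all minors through the pivot vanish,
    [N = u v] has rank one; determinant 1 forces [v u = 0], so [N] squares to zero and [g ^ k] acts
    as [1 + k N]. Taking for [k] the order of [g] gives [N = 0] in characteristic zero. *)
Lemma unimodular_not_reflection g :
    \det (rG g) = 1 -> rG g != 1%:M ->
  exists i0 j0 i1 j1, let N := rG g - 1%:M in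
    N i0 j0 != 0 /\ N i1 j1 * N i0 j0 != N i0 j1 * N i1 j0.
Proof.
move=> det1g ng1 /=; move Ng: (rG g - 1%:M) => N.
have [i0 [j0 N0]] : exists i0 j0, N i0 j0 != 0.
  by apply/matrix0Pn; rewrite -Ng subr_eq0.
exists i0, j0; apply: contrapT => noij.
have rank1 i j : N i j * N i0 j0 = N i0 j * N i j0.
  by apply/eqP; apply: contrapT => /negP neq; apply: noij; exists i, j.
pose u : 'cV[C]_n := col j0 N; pose v : 'rV[C]_n := (N i0 j0)^-1 *: row i0 N.
have EN : N = u *m v.
  apply/matrixP=> i j; rewrite !mxE big_ord1 !mxE.
  by apply: (mulIf N0); rewrite rank1 -mulrA [_^-1 * _]mulrC divfK // mulrC.
have Eg : rG g = 1%:M + u *m v by rewrite -EN -Ng addrC subrK.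
have vu : v *m u = 0.
  apply/matrixP=> i j; rewrite !ord1 [RHS]mxE.
  move: det1g; rewrite Eg det_1Dmul det_mx11 !mxE eqxx => /(canRL (addKr _)).
  by rewrite addNr.
have NN : N *m N = 0 by rewrite EN mulmxA -[u *m v *m u]mulmxA vu mulmx0 mul0mx.
have Xg k : rG (g ^+ k)%g = 1%:M + k%:R *: N.
  elim: k => [|k IH]; first by rewrite repr_mx1 scale0r addr0.
  rewrite expgS repr_mxM ?inE // IH Eg -EN mulmxDl mul1mx mulmxDr mulmx1.
  by rewrite -scalemxAr NN scaler0 addr0 -addrA -natr1 scalerDl scale1r.
have := Xg #[g]%g; rewrite expg_order repr_mx1 -[X in X = _]addr0 => /addrI/esym/eqP.
rewrite scaler_eq0 pnatr_eq0 -leqn0 leqNgt order_gt0 /=.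
by rewrite -Ng subr_eq0 (negPf ng1).
Qed.

(** [g] moves ['X_j] by the linear form of column [j] of [rG g - 1], and the nonzero minor makes two
    such columns non-proportional. *)
Lemma poly_act_var_prime_to g :
    \det (rG g) = 1 -> rG g != 1%:M ->
  exists s s', let act := poly_act rG in
    act g s - s != 0 /\ prime_to (act g s - s) (act g s' - s').
Proof.
move=> det1g ng1; have [i0 [j0 [i1 [j1 [N0 N1]]]]] := unimodular_not_reflection det1g ng1.
have actX j : poly_act rG g 'X_j - 'X_j = linear_form (fun i => (rG g - 1%:M) i j).
  rewrite /= comp_mpolyXU -tnth_nth tnth_mktuple /linear_form.
  under [RHS]eq_bigr => i _ do rewrite !mxE scalerBl.
  rewrite sumrB; congr (_ - _); rewrite (bigD1 j) //= eqxx scale1r big1 ?addr0 //.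
  by move=> i /negPf ->; rewrite scale0r.
exists 'X_j0, 'X_j1; rewrite /= !actX; split; last first.
  exact: (@prime_to_linear_form _ _ (fun i => (rG g - 1%:M) i j0)
    (fun i => (rG g - 1%:M) i j1) i0 i1 N0 N1).
apply: contraNneq N0 => l0.
have := linear_form_coef (fun i => (rG g - 1%:M) i j0) i0.
by rewrite l0 mcoeff0 => /esym/eqP.
Qed.

End NoReflections.
(** * The isomorphisms onto (S*N)*H and End (S*H) *)

Lemma inj_surj_bij (T U : Type) (f : T -> U) :
  injective f -> (forall y, exists x, f x = y) -> bijective f.
Proof.
move=> f_inj /choice[g gK]; exists g => // x; exact/f_inj/gK.
Qed.

Lemma tgr_mul_delta1 (C : comNzRingType) (S : algType C) (gT : finGroupType)
    (act : algAction S gT) (a : tgring act) s g :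
  (a * tdelta act s 1%g) g = a g * act g s.
Proof.
rewrite tgr_mulE (bigD1 g) //= ffunE mulVg eqxx big1 ?addr0 // => h ne.
rewrite ffunE -(inj_eq (mulgI h)) mulKVg mulg1 eq_sym (negPf ne).
by rewrite raddf0 mulr0.
Qed.

Lemma compl_sub_mul (gT : finGroupType) (N H : {group gT}) :
  (H \in [complements to N in [set: gT]])%g -> forall g, g \in (N * H)%g.
Proof. by case/complP=> _ -> g; rewrite inE. Qed.

Section ComplementDecomposition.
Variables (C : comNzRingType) (S : algType C) (gT : finGroupType).
Variables (act : algAction S gT) (N H : {group gT}).
Hypothesis nNH : (H \subset 'N(N))%g.

Notation SN := (tgring (res_act act N)).
Notation SNH := (tgring (conj_act act nNH)).
Notation SH := (restr (tgr_incl act nNH)).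

(** Every [g] is uniquely [k * h]; [divgr] and [remgr] extract the two factors. *)
Lemma sum_compl (V : nmodType) (F : gT -> V) :
    (H \in [complements to N in [set: gT]])%g ->
  \sum_g F g = \sum_(h : subg_of H) \sum_(k : subg_of N) F (sgval k * sgval h)%g.
Proof.
move=> compl; have inNH := compl_sub_mul compl; have [tiNH _] := complP compl.
rewrite pair_bigA /=.
rewrite (reindex (fun u : subg_of H * subg_of N => sgval u.2 * sgval u.1)%g) //=.
exists (fun g => (subg H (remgr N H g), subg N (divgr N H g))) => [[h k] _|g _] /=.
  by rewrite remgrMid ?divgrMid ?subgP // !sgvalK.
by rewrite !subgK ?mem_remgr ?mem_divgr // -divgr_eq.
Qed.

(** The map [s delta_(k h) |-> (s delta_k) delta_h]. *)
Definition tgr_split (a : tgring act) : SNH :=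
  [ffun h => [ffun k => a (sgval k * sgval h)%g]].

Lemma tgr_split_is_linear : linear tgr_split.
Proof. by move=> k a b; apply/ffunP=> h; apply/ffunP=> l; rewrite !ffunE. Qed.

(** Since [delta_h delta_k = delta_(h k h^-1) delta_h], the twist in [conj_act] is exactly what
    multiplying two factorizations [k h] requires. *)
Lemma tgr_split_is_monoid :
  (H \in [complements to N in [set: gT]])%g -> monoid_morphism tgr_split.
Proof.
move=> compl; have [tiNH _] := complP compl.
split=> [|a b]; apply/ffunP=> h; apply/ffunP=> k.
  rewrite !ffunE.
  have -> : (sgval k * sgval h == 1)%g = (k == 1%g) && (h == 1%g).
    apply/eqP/andP=> [kh1|[/eqP-> /eqP->]]; last by rewrite mulg1.
    have := congr1 (remgr N H) kh1; have := congr1 (divgr N H) kh1.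
    rewrite remgrMid ?divgrMid ?subgP // remgr1 // divgr_id // => k1 h1.
    by rewrite -!(inj_eq val_inj) /= k1 h1.
  by have [_|_] := eqVneq h 1%g; rewrite ?andbT ?andbF ffunE.
rewrite !ffunE !tgr_mulE sum_compl // tgr_sumE; apply: eq_bigr => h' _.
rewrite tgr_mulE; apply: eq_bigr => k' _.
rewrite !ffunE alg_actM subgK; last exact: (memJ_sub nNH h' (k'^-1 * k)%g).
by rewrite /= conjgE invMg !mulgA mulgK.
Qed.

Definition tgr_split_lrm (compl : (H \in [complements to N in [set: gT]])%g) :
    {lrmorphism tgring act -> SNH} :=
  HB.pack tgr_split
    (GRing.isLinear.Build C _ _ _ tgr_split tgr_split_is_linear)
    (GRing.isMonoidMorphism.Build _ _ tgr_split (tgr_split_is_monoid compl)).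

Lemma tgr_split_bij :
  (H \in [complements to N in [set: gT]])%g -> bijective tgr_split.
Proof.
move=> compl; have inNH := compl_sub_mul compl; have [tiNH _] := complP compl.
exists (fun b : SNH => [ffun g => b (subg H (remgr N H g)) (subg N (divgr N H g))]) => [a|b].
  by apply/ffunP=> g; rewrite !ffunE !subgK ?mem_remgr ?mem_divgr // -divgr_eq.
apply/ffunP=> h; apply/ffunP=> k.
by rewrite !ffunE remgrMid ?divgrMid ?subgP // !sgvalK.
Qed.

(** Auslander's operator viewed on [S] itself, where it can be declared [C]-linear. *)
Definition auslander_fun (a : SN) (x : S) : S := auslander (res_act act N) a x.

Lemma auslander_funE a x : auslander_fun a x = \sum_k a k * act (sgval k) x.
Proof. by []. Qed.

Lemma auslander_funM a b x :
  auslander_fun (a * b) x = auslander_fun a (auslander_fun b x).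
Proof. by rewrite /auslander_fun rmorphM. Qed.

Lemma auslander_fun1 x : auslander_fun 1 x = x.
Proof. by rewrite /auslander_fun rmorph1. Qed.

Lemma auslander_fun_linear a : linear (auslander_fun a).
Proof.
move=> c x y; rewrite !auslander_funE scaler_sumr -big_split; apply: eq_bigr => k _ /=.
by rewrite linearP mulrDr scalerAr.
Qed.

HB.instance Definition _ a :=
  GRing.isLinear.Build C _ _ _ (auslander_fun a) (auslander_fun_linear a).

Lemma auslander_fun_linearl x : linear (auslander_fun^~ x).
Proof.
move=> c a b; rewrite !auslander_funE scaler_sumr -big_split; apply: eq_bigr => k _ /=.
by rewrite !ffunE mulrDl scalerAl.
Qed.

Lemma auslander_fun_suml (I : Type) (r : seq I) (F : I -> SN) x :
  auslander_fun (\sum_(i <- r) F i) x = \sum_(i <- r) auslander_fun (F i) x.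
Proof.
elim/big_rec2: _ => [|i y1 y2 _ <-].
  by rewrite auslander_funE big1 // => k _; rewrite ffunE mul0r.
by have := auslander_fun_linearl x 1 (F i) y2; rewrite !scale1r.
Qed.

(** From [h k = (h k h^-1) h]; this is what makes [skew_op] multiplicative. *)
Lemma auslander_fun_conj (h : subg_of H) a x :
  act (sgval h) (auslander_fun a x) = auslander_fun (conj_act act nNH h a) (act (sgval h) x).
Proof.
rewrite !auslander_funE rmorph_sum /=.
pose c (l : subg_of N) := subg N ((sgval l ^ sgval h)%g).
have c_inj : injective c.
  move=> l m /(congr1 val); rewrite /= !subgK ?memJ_sub // => /conjg_inj.
  exact: val_inj.
rewrite (reindex_inj c_inj); apply: eq_bigr => l _.
rewrite ffunE rmorphM /= -!alg_actM; congr (_ * act _ x).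
by rewrite subgK ?memJ_sub // conjgE mulKVg.
Qed.

Lemma auslander_fun_inv a x c :
  c \in Defs.invariant act N -> auslander_fun a (x * c) = auslander_fun a x * c.
Proof.
move=> /invariantP invc; rewrite !auslander_funE mulr_suml.
by apply: eq_bigr => k _; rewrite rmorphM /= invc ?subgP // mulrA.
Qed.

(** On coefficients, the action in which [(s delta_k) delta_h] sends [t delta_l] to
    [s k(h(t)) delta_(h l)]. *)
Definition skew_op_fun (b : SNH) (m : SH) : SH :=
  [ffun k : subg_of H =>
    \sum_(h : subg_of H)
      auslander_fun (b h) (act (sgval h) ((m : {ffun _ -> S}) (h^-1 * k)%g))].

(** The coefficients of a scalar lie in [S^N], which [H] preserves since it normalizes [N]; so they
    pull out of every [auslander_fun (b h)]. *)
Lemma skew_op_linear b : linear (skew_op_fun b).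
Proof.
move=> c m m'; apply/ffunP=> k; rewrite restr_scaleE /=.
rewrite [RHS]ffunE [X in _ = X + _]tgr_mulE !ffunE.
transitivity (skew_op_fun b (m * tgr_incl act nNH c) k + skew_op_fun b m' k).
  rewrite !ffunE -big_split; apply: eq_bigr => h _ /=.
  by rewrite ffunE !raddfD.
rewrite !ffunE; congr (_ + _).
transitivity (\sum_h \sum_l auslander_fun (b h) (act (sgval h) (m (h^-1 * l)%g)) *
                 act (sgval l) (tgr_incl act nNH c (l^-1 * k)%g)).
  apply: eq_bigr => h _; rewrite tgr_mulE !raddf_sum (reindex_inj (mulgI h^-1%g)).
  apply: eq_bigr => l _ /=.
  rewrite rmorphM /= auslander_fun_inv -?alg_actM.
    by rewrite mulKVg invMg invgK mulgA mulgK.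
  by rewrite mulKVg ffunE; exact: (inv_fun_subproof nNH l).
rewrite exchange_big; apply: eq_bigr => l _ /=.
by rewrite [skew_op_fun b m l]ffunE mulr_suml.
Qed.

Definition skew_op (b : SNH) : rEnd SH := mkREnd (skew_op_linear b).

Lemma skew_op_is_linear : linear skew_op.
Proof.
move=> c a b; apply: rEndP => m /=; rewrite restr_scaleE linearZ rmorph1 mulr_algr.
apply/ffunP=> k; rewrite !ffunE scaler_sumr -big_split; apply: eq_bigr => h _ /=.
by rewrite !ffunE auslander_fun_linearl.
Qed.

Lemma skew_op_is_monoid : monoid_morphism skew_op.
Proof.
split=> [|a b]; apply: rEndP => m; apply/ffunP=> k; rewrite /= ffunE.
  rewrite (bigD1 1%g) //= ffunE eqxx big1 => [|h /negPf ne].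
    by rewrite addr0 auslander_fun1 alg_act1 invg1 mul1g.
  by rewrite ffunE ne auslander_funE big1 // => l _; rewrite ffunE mul0r.
rewrite ffunE; under eq_bigr => h _ do rewrite tgr_mulE auslander_fun_suml.
rewrite exchange_big; apply: eq_bigr => h _ /=.
rewrite ffunE !raddf_sum (reindex_inj (mulgI h)); apply: eq_bigr => l _ /=.
rewrite auslander_funM auslander_fun_conj mulKg /= alg_actM.
by rewrite invMg mulgA.
Qed.

HB.instance Definition _ :=
  GRing.isLinear.Build C _ _ _ skew_op skew_op_is_linear.
HB.instance Definition _ :=
  GRing.isMonoidMorphism.Build _ _ skew_op skew_op_is_monoid.

Lemma skew_op_delta b x k :
  (skew_op b (tdelta (res_act act H) x 1%g) : {ffun _ -> S}) k =
  auslander_fun (b k) (act (sgval k) x).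
Proof.
rewrite ffunE (bigD1 k) //= ffunE mulVg eqxx big1 ?addr0 // => h ne.
rewrite ffunE -(inj_eq (mulgI h)) mulKVg mulg1 eq_sym (negPf ne).
by rewrite !raddf0.
Qed.

Lemma tgr_incl_delta c h :
  tgr_incl act nNH (tdelta (inv_act act nNH) c h) = tdelta (res_act act H) (val c) h.
Proof. by apply/ffunP=> k; rewrite !ffunE; case: ifP. Qed.

(** As [x delta_h = (x delta_1) delta_h], the elements [x delta_1] generate the right module. *)
Lemma restr_delta_expand (m : SH) :
  m = \sum_h (tdelta (inv_act act nNH) 1 h : (tgring (inv_act act nNH))^c) *:
              (tdelta (res_act act H) ((m : {ffun _ -> S}) h) 1%g : SH).
Proof.
rewrite [LHS]tdelta_sum; apply: eq_bigr => h _; rewrite restr_scaleE /=.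
by rewrite tgr_incl_delta tdeltaM rmorph1 mulr1 mul1g.
Qed.

Lemma restr_rEnd_ext (F G : rEnd SH) :
    (forall x, F (tdelta (res_act act H) x 1%g) = G (tdelta (res_act act H) x 1%g)) ->
  F = G.
Proof.
move=> FG; apply: rEndP => m; rewrite [m]restr_delta_expand.
rewrite (big_morph F (rEndD F) (rEnd0 F)) (big_morph G (rEndD G) (rEnd0 G)).
by apply: eq_bigr => h _; rewrite !rEndZ FG.
Qed.

(* F is determined by the components x |-> F (x delta_1) h; precomposing them
   with h^-1 makes them S^N-linear, so Auslander's theorem for N applies. *)
Lemma skew_op_bij : bijective (auslander (res_act act N)) -> bijective skew_op.
Proof.
move=> bijA; apply: inj_surj_bij => [a b Eab|F].
  apply/ffunP=> h; apply: (bij_inj bijA); apply: rEndP => x.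
  have := congr1 (fun f : rEnd SH =>
    (f (tdelta (res_act act H) (act (sgval h^-1%g) x) 1%g) : {ffun _ -> S}) h) Eab.
  by rewrite !skew_op_delta -alg_actM mulgV alg_act1.
pose f (h : subg_of H) (x : S) : S :=
  (F (tdelta (res_act act H) (act (sgval h^-1%g) x) 1%g) : {ffun _ -> S}) h.
have f_lin h :
    linear (f h : restr (inclG (res_act act N)) -> restr (inclG (res_act act N))).
  move=> c x y; rewrite restr_scaleE /f.
  have invc :
      act (sgval h^-1%g) (val (c : invs (res_act act N) _)) \in Defs.invariant act N.
    have cN : val (c : invs (res_act act N) _) \in Defs.invariant act N.
      apply/invariantP=> g Ng; have /invariantP := valP (c : invs (res_act act N) _).
      by move/(_ (subg N g)); rewrite /= subgK // inE => ->.
    exact: (inv_fun_subproof nNH h^-1%g (Invs cN)).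
  (* The scalar [c] enters as [h^-1(c)]; reading the result at [h] applies [h] and returns [c]. *)
  have -> : tdelta (res_act act H)
        (act (sgval h^-1%g) (x * inclG (res_act act N) c + y)) 1%g =
     (tdelta (inv_act act nNH) (Invs invc) 1%g : (tgring (inv_act act nNH))^c) *:
       (tdelta (res_act act H) (act (sgval h^-1%g) x) 1%g : SH) +
       (tdelta (res_act act H) (act (sgval h^-1%g) y) 1%g : SH).
    rewrite restr_scaleE /= tgr_incl_delta tdeltaM /= alg_act1 mulg1 -rmorphM.
    by apply/ffunP=> k; rewrite !ffunE; case: ifP; rewrite ?addr0 // rmorphD.
  rewrite rEndD rEndZ restr_scaleE /= tgr_incl_delta ffunE tgr_mul_delta1 /=.
  by rewrite -alg_actM mulgV alg_act1.
have [A AK KA] := bijA.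
exists [ffun h => A (mkREnd (f_lin h))]; apply: restr_rEnd_ext => x.
apply/ffunP=> h; rewrite skew_op_delta ffunE /auslander_fun KA /= /f.
by rewrite -alg_actM mulVg alg_act1.
Qed.

(** With [H] trivial only the coefficient at 1 remains, and the sum over [subg_of N] is the sum over
    [gT]. *)
Lemma skew_op_split_delta (a : tgring act) x :
    N = [set: gT] :> {set gT} -> (forall h : subg_of H, h = 1%g) ->
  skew_op (tgr_split a) (tdelta (res_act act H) x 1%g) =
  tdelta (res_act act H) (auslander act a x : S) 1%g.
Proof.
move=> NT H1; apply/ffunP=> h; rewrite [LHS]skew_op_delta (H1 h) [RHS]ffunE eqxx.
rewrite auslander_funE alg_act1 /= [RHS](reindex (@sgval gT N)) /=.
  by apply: eq_bigr => k _; rewrite !ffunE mulg1.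
exists (subg N) => [k _|g _]; first exact: sgvalK.
by rewrite subgK // NT inE.
Qed.

End ComplementDecomposition.

(** * The corner algebra of the averaging idempotent *)

Section ExtendByZero.
Variables (C : comNzRingType) (S : algType C) (gT : finGroupType).
Variables (act : algAction S gT) (H : {group gT}).

Definition tgr_ext (m : tgring (res_act act H)) : tgring act :=
  \sum_h tdelta act (m h) (sgval h).

Lemma tgr_ext_is_linear : linear tgr_ext.
Proof.
move=> k a b; rewrite /tgr_ext scaler_sumr -big_split; apply: eq_bigr => h _ /=.
by apply/ffunP=> l; rewrite !ffunE; case: ifP; rewrite ?scaler0 ?addr0.
Qed.

HB.instance Definition _ := GRing.isLinear.Build C _ _ _ tgr_ext tgr_ext_is_linear.

Lemma tgr_ext_delta s h :
  tgr_ext (tdelta (res_act act H) s h) = tdelta act s (sgval h).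
Proof.
rewrite /tgr_ext (bigD1 h) //= ffunE eqxx big1 ?addr0 // => k /negPf ne.
by rewrite ffunE ne; apply/ffunP=> l; rewrite !ffunE; case: ifP.
Qed.

Lemma tgr_ext_is_monoid : monoid_morphism tgr_ext.
Proof.
split=> [|a b]; first by rewrite tgr_ext_delta.
rewrite [a in LHS]tdelta_sum [b in LHS]tdelta_sum mulr_suml raddf_sum /= mulr_suml.
apply: eq_bigr => g _; rewrite !mulr_sumr raddf_sum; apply: eq_bigr => h _ /=.
by rewrite !tdeltaM tgr_ext_delta.
Qed.

HB.instance Definition _ :=
  GRing.isMonoidMorphism.Build _ _ tgr_ext tgr_ext_is_monoid.

Lemma tdelta_mulE g (a : tgring act) k :
  (tdelta act 1 g * a) k = act g (a (g^-1 * k)%g).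
Proof.
rewrite tgr_mulE (bigD1 g) //= ffunE eqxx mul1r big1 ?addr0 // => h /negPf ne.
by rewrite ffunE ne mul0r.
Qed.

Lemma mul_tdeltaE g (a : tgring act) k :
  (a * tdelta act 1 g) k = a (k * g^-1)%g.
Proof.
rewrite tgr_mulE (bigD1 (k * g^-1)%g) //= ffunE invMg invgK mulgKV eqxx.
rewrite rmorph1 mulr1 big1 ?addr0 // => h ne; rewrite ffunE.
case: eqP => [e|_]; last by rewrite rmorph0 mulr0.
by case/eqP: ne; rewrite -e invMg invgK mulKVg.
Qed.

End ExtendByZero.

(** * The isomorphisms of [S*H] with [Ae] and of [S^N*H] with [eAe] *)

Section AveragingIdempotent.
Variables (C : numFieldType) (S : algType C) (gT : finGroupType).
Variables (act : algAction S gT) (N H : {group gT}).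
Hypothesis nNH : (H \subset 'N(N))%g.

Notation e := (avg_idempotent act N).
Notation SH := (restr (tgr_incl act nNH)).
Notation invs_H := (tgring (inv_act act nNH)).

Lemma avgE k : avg act N k = #|N|%:R^-1 *: (k \in N)%:R.
Proof.
rewrite ffunE tgr_sumE; congr (_ *: _); case: (boolP (k \in N)) => Nk.
  rewrite (bigD1 k) //= ffunE eqxx big1 ?addr0 // => g /andP[_ /negPf ne].
  by rewrite ffunE eq_sym ne.
rewrite big1 // => g Ng; rewrite ffunE; case: eqP => // kg.
by rewrite kg Ng in Nk.
Qed.

Lemma avg_mul_tdelta g : g \in N -> avg act N * tdelta act 1 g = avg act N.
Proof.
by move=> Ng; apply/ffunP=> k; rewrite mul_tdeltaE !avgE groupMr ?groupV.
Qed.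

Lemma tdelta_mul_avg g : g \in N -> tdelta act 1 g * avg act N = avg act N.
Proof.
move=> Ng; apply/ffunP=> k; rewrite tdelta_mulE !avgE groupMl ?groupV //.
by rewrite linearZ /= rmorph_nat.
Qed.

(** The idempotent commutes with [delta_h] because [h] normalizes [N], and with [S^N] because
    [delta_k c = k(c) delta_k]. *)
Lemma avg_comm_incl (b : invs_H) :
  avg act N * tgr_ext (tgr_incl act nNH b) = tgr_ext (tgr_incl act nNH b) * avg act N.
Proof.
rewrite /tgr_ext mulr_sumr mulr_suml; apply: eq_bigr => h _; rewrite ffunE.
rewrite /invs_incl.
apply/ffunP=> k; rewrite !tgr_mulE.
(* Only one term can be nonzero on each side: at [k h^-1] on the left, at [h] on the right. *)
rewrite (bigD1 (k * (sgval h)^-1)%g) //= [X in _ + X = _]big1 => [|g ne]; last first.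
  rewrite [tdelta _ _ _ _]ffunE; case: eqP => [eh|_]; last by rewrite rmorph0 mulr0.
  by case/eqP: ne; rewrite -eh invMg invgK mulKVg.
rewrite [RHS](bigD1 (sgval h)) //= [X in _ = _ + X]big1 => [|g /negPf ne]; last first.
  by rewrite [tdelta _ _ _ _]ffunE ne mul0r.
rewrite ![tdelta _ _ _ _]ffunE !addr0 invMg invgK mulgKV !eqxx !avgE.
have -> : (k * (sgval h)^-1 \in N)%g = ((sgval h)^-1 * k \in N)%g.
  rewrite -(memJ_norm _ (subsetP nNH _ (subgP h))) conjgE.
  by rewrite mulgKV.
case: (boolP (_ \in N)) => [hkN|_]; last by rewrite !scaler0 rmorph0 mulr0 mul0r.
rewrite -scalerAl mul1r linearZ /= rmorph1 -scalerAr mulr1; congr (_ *: _).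
apply: (elimT (invariantP _ _ _) (valP (b h))).
by rewrite -(memJ_norm _ (subsetP nNH _ (subgP h))) conjgE mulgKV.
Qed.

Fact avg_lideal_subproof (m : SH) : tgr_ext m * avg act N \in in_lideal e.
Proof. by apply/in_lidealP; exists (tgr_ext m). Qed.

Definition to_avg_lideal (m : SH) : lideal e := Lideal (avg_lideal_subproof m).

Lemma to_avg_lideal_is_zmod : zmod_morphism to_avg_lideal.
Proof. by move=> a b; apply: val_inj; rewrite /= raddfB mulrBl. Qed.

HB.instance Definition _ :=
  GRing.isZmodMorphism.Build SH (lideal e) to_avg_lideal to_avg_lideal_is_zmod.

Fact avg_corner_subproof (b : invs_H) :
  tgr_ext (tgr_incl act nNH b) * avg act N \in in_corner e.
Proof.
apply/in_cornerP; exists (tgr_ext (tgr_incl act nNH b)).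
by rewrite /= avg_comm_incl -mulrA avg_idem.
Qed.

Definition to_avg_corner (b : invs_H) : corner e := Corner (avg_corner_subproof b).

Lemma to_avg_corner_is_linear : linear to_avg_corner.
Proof. by move=> k a b; apply: val_inj; rewrite /= !linearP /= mulrDl scalerAl. Qed.

Lemma to_avg_corner_is_monoid : monoid_morphism to_avg_corner.
Proof.
split=> [|a b]; apply: val_inj; rewrite /= ?rmorph1 ?mul1r //.
rewrite !rmorphM /= -!mulrA; congr (_ * _).
by rewrite [RHS]mulrA avg_comm_incl -mulrA avg_idem.
Qed.

HB.instance Definition _ :=
  GRing.isLinear.Build C _ _ _ to_avg_corner to_avg_corner_is_linear.
HB.instance Definition _ :=
  GRing.isMonoidMorphism.Build _ _ to_avg_corner to_avg_corner_is_monoid.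

(** By commutation, [(m e) (b e) = m b e e = m b e]. *)
Lemma to_avg_lideal_scale (b : invs_H^c) (m : SH) :
  to_avg_lideal (b *: m) = (to_avg_corner b : (corner e)^c) *: to_avg_lideal m.
Proof.
apply: val_inj; rewrite /= restr_scaleE rmorphM /= -!mulrA; congr (_ * _).
by rewrite mulrA avg_comm_incl -mulrA avg_idem.
Qed.

Hypothesis compl : (H \in [complements to N in [set: gT]])%g.

(** [delta_h e] is [|N|^-1] times the sum over the coset [h N = N h], which contains [g] exactly
    when [h] is the [H]-part of [g]. *)
Lemma to_avg_lidealE (m : SH) g :
  (val (to_avg_lideal m) : {ffun gT -> S}) g =
  #|N|%:R^-1 *: (m : {ffun subg_of H -> S}) (subg H (remgr N H g)).
Proof.
have inNH := compl_sub_mul compl; have [tiNH _] := complP compl.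
rewrite /= /tgr_ext mulr_suml tgr_sumE.
set h0 := subg H _; have h0E : sgval h0 = remgr N H g by rewrite subgK ?mem_remgr.
have E h : (tdelta act (m h) (sgval h) * avg act N) g =
    if h == h0 then #|N|%:R^-1 *: m h else 0.
  rewrite tgr_mulE (bigD1 (sgval h)) //= big1 => [|k /negPf ne]; last first.
    by rewrite [tdelta _ _ _ _]ffunE ne mul0r.
  rewrite [tdelta _ _ _ _]ffunE eqxx addr0 avgE linearZ /= rmorph_nat -scalerAr.
  have -> : ((sgval h)^-1 * g \in N)%g = (h == h0).
    rewrite -(memJ_norm _ (subsetP nNH (sgval h)^-1%g _)) ?groupV ?subgP //.
    rewrite conjgE invgK -mulgA mulKVg -(inj_eq val_inj) /= h0E.
    apply/idP/eqP=> [gN|->].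
      by rewrite -[g in RHS](mulgKV (sgval h)) remgrMid ?subgP.
    by rewrite {1}(divgr_eq N H g) mulgK mem_divgr.
  by case: eqP => _; rewrite ?mulr1 // mulr0 scaler0.
by rewrite (bigD1 h0) //= E eqxx big1 ?addr0 // => h /negPf ne; rewrite E ne.
Qed.

Lemma card_unit : #|N|%:R != 0 :> C.
Proof. by rewrite pnatr_eq0 -lt0n cardG_gt0. Qed.

Lemma lideal_avg_invr (x : lideal e) g k :
  k \in N -> (val x : {ffun gT -> S}) (g * k)%g = (val x : {ffun gT -> S}) g.
Proof.
move=> Nk; rewrite -[in LHS](lideal_Ke x) -[idem_val e](avg_mul_tdelta Nk) mulrA.
by rewrite mul_tdeltaE mulgK [_ * _](lideal_Ke x).
Qed.


Lemma corner_avg_invl (x : corner e) g k :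
  k \in N -> (val x : {ffun gT -> S}) (k * g)%g = act k ((val x : {ffun gT -> S}) g).
Proof.
move=> Nk; rewrite -[in LHS](corner_eK x) -[idem_val e](tdelta_mul_avg Nk) -mulrA.
by rewrite tdelta_mulE mulKg [_ * _](corner_eK x).
Qed.

Lemma to_avg_lideal_bij : bijective to_avg_lideal.
Proof.
have [tiNH _] := complP compl.
apply: inj_surj_bij => [m m' Em|x].
  apply/ffunP=> h.
  have := congr1 (fun x : lideal e => (val x : {ffun gT -> S}) (sgval h)) Em.
  rewrite !to_avg_lidealE remgr_id ?subgP // sgvalK => /(congr1 ( *:%R #|N|%:R)).
  by rewrite !scalerA mulfV ?card_unit // !scale1r.
(* The factor [#|N|] undoes the normalization of the idempotent. *)
exists [ffun h => #|N|%:R *: (val x : {ffun gT -> S}) (sgval h)].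
apply: val_inj; apply/ffunP=> g; rewrite to_avg_lidealE ffunE scalerA mulVf ?card_unit //.
have inNH := compl_sub_mul compl g.
(* Write [g = k h = h k^h] and absorb the factor in [N] on the right. *)
rewrite scale1r subgK ?mem_remgr // [g in RHS](divgr_eq N H) conjgC.
by rewrite lideal_avg_invr // memJ_norm ?mem_divgr // (subsetP nNH) ?mem_remgr.
Qed.

(** On underlying elements this is [to_avg_lideal] on [S^N*H], whence injectivity. An element [y] of
    the corner lies in [Ae], and its coefficients on [H] are invariant:
    [k(y_h) = y_(k h) = y_(h k^h) = y_h] for [k] in [N]. *)
Lemma to_avg_corner_bij : bijective to_avg_corner.
Proof.
have [tiNH _] := complP compl; have [A AK KA] := to_avg_lideal_bij.
apply: inj_surj_bij => [b b' Eb|y].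
  have Em : tgr_incl act nNH b = tgr_incl act nNH b' :> SH.
    by apply: (bij_inj to_avg_lideal_bij); apply: val_inj; apply: (congr1 val Eb).
  apply/ffunP=> h; apply: val_inj.
  by have := congr1 (fun m : SH => (m : {ffun subg_of H -> S}) h) Em; rewrite !ffunE.
have yl : val y \in in_lideal e by apply/in_lidealP; exists (val y); rewrite corner_Ke.
have invy (h : subg_of H) :
    #|N|%:R *: (val y : {ffun gT -> S}) (sgval h) \in Defs.invariant act N.
  apply/invariantP=> k Nk.
  rewrite linearZ /= -corner_avg_invl // conjgC (lideal_avg_invr (Lideal yl)) //.
  by rewrite memJ_norm // (subsetP nNH) ?subgP.
exists [ffun h : subg_of H => Invs (invy h)].
have [m my] : exists m : SH, to_avg_lideal m = Lideal yl by exists (A (Lideal yl)).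
apply: val_inj; rewrite -[RHS]/(val (Lideal yl)) -my.
congr (tgr_ext _ * _); apply/ffunP=> h; rewrite !ffunE /=.
have := congr1 (fun x : lideal e => (val x : {ffun gT -> S}) (sgval h)) my.
rewrite to_avg_lidealE remgr_id ?subgP // sgvalK /= => yE.
rewrite -[LHS]/(#|N|%:R *: (val y : {ffun gT -> S}) (sgval h)) -yE.
by rewrite scalerA mulfV ?card_unit // scale1r.
Qed.

End AveragingIdempotent.

(** * Auslander's theorem for polynomial rings and the final assembly *)

Lemma auslander_bij (C : numFieldType) (n : nat) (gT kT : finGroupType)
    (rG : mx_representation C [set: gT] n) (act : algAction {mpoly C[n]} kT)
    (f : kT -> gT) :
    (forall k x, act k x = poly_act rG (f k) x) ->
    (forall k, k != 1%g -> \det (rG (f k)) = 1 /\ rG (f k) != 1%:M) ->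
  bijective (auslander act).
Proof.
move=> actE unimod.
pose ract k : {rmorphism {mpoly C[n]} -> {mpoly C[n]}} := act k.
have ractE k x : ract k x = poly_act rG (f k) x := actE k x.
have act1 s : ract 1%g s = s by apply: alg_act1.
have actM g h s : ract (g * h)%g s = ract g (ract h s) by apply: alg_actM.
have cop k : k != 1%g -> exists s s',
    ract k s - s != 0 /\ prime_to (ract k s - s) (ract k s' - s').
  move=> /unimod[det1 ne1]; have [s [s' sP]] := poly_act_var_prime_to det1 ne1.
  by exists s, s'; rewrite !ractE.
apply: inj_surj_bij => [a b Eab|F].
  apply/ffunP; apply: (skew_rep_inj act1 actM) => [k /cop[s [_ [s0 _]]]|x].
    by exists s; rewrite -subr_eq0.
  have := congr1 (fun G : rEnd (restr (inclG act)) => G x) Eab; exact.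
have Flin : inv_linear ract F.
  split=> [x y|x c invc]; first exact: (rEndD F x y).
  have inv_c : c \in Defs.invariant act [set: kT] by apply/invariantP=> k _; apply: invc.
  exact: (rEndZ F (Invs inv_c : (invs act [set: kT])^c) x).
have [a Ea] := inv_linear_skew_rep act1 actM cop Flin.
exists [ffun k => a k]; apply: rEndP => x; rewrite [RHS]Ea /=.
by apply: eq_bigr => k _; rewrite ffunE.
Qed.

Theorem theoremB (R : realType) (n : nat) (gT : finGroupType)
    (rG : mx_representation R[i] [set: gT] n) (H : {group gT}) :
  mx_faithful rG ->
  (H \in [complements to SLpart rG in [set: gT]])%g ->
  let Gam := SLpart rG in
  let nGamH : (H \subset 'N(Gam))%g := SLpart_norm rG H in
  let act := poly_act rG in
  let e := avg_idempotent act Gam in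
  let SG := tgring act in
  let SGam_H := tgring (conj_act act nGamH) in
  let SH := restr (tgr_incl act nGamH) in
  let invs_H := tgring (inv_act act nGamH) in
  exists (Phi : {lrmorphism SG -> SGam_H})
         (Psi : {lrmorphism SGam_H -> rEnd SH})
         (phi : {lrmorphism invs_H -> corner e})
         (theta : {additive SH -> lideal e}),
    [/\ bijective Phi,
        bijective Psi,
        bijective phi,
        bijective theta /\
          (forall (b : invs_H^c) (m : SH),
             theta (b *: m) = (phi b : (corner e)^c) *: theta m) &
        Gam = [set: gT] :> {set gT} ->
          let j (x : {mpoly R[i][n]}) : SH := tdelta (res_act act H) x 1%g in
          [/\ bijective j,
              bijective (auslander act) &
              forall (a : SG) (x : {mpoly R[i][n]}),
                Psi (Phi a) (j x) = j (auslander act a x)]].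
Proof.
move=> faithful compl Gam nGamH act e SG SGam_H SH invs_H.
have rG_neq1 g : g != 1%g -> rG g != 1%:M.
  apply: contra_neq => rg1; apply/set1gP; apply: (subsetP faithful).
  by rewrite inE rg1 mulmx1 inE eqxx.
(* Auslander's theorem for [Gam], embedded by [sgval]: determinants are 1 by definition, and
   faithfulness excludes the identity matrix. *)
have auslN : bijective (auslander (res_act act Gam)).
  apply: (@auslander_bij _ _ _ _ rG _ sgval) => // k k1.
  split; last by apply: rG_neq1; rewrite (inj_eq val_inj k 1%g).
  by have := subgP k; rewrite inE => /eqP.
exists (tgr_split_lrm act nGamH compl), (@skew_op _ _ _ act Gam H nGamH).
exists (@to_avg_corner _ _ _ act Gam H nGamH), (@to_avg_lideal _ _ _ act Gam H nGamH).
split.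
- exact: tgr_split_bij.
- exact: skew_op_bij.
- exact: to_avg_corner_bij.
- by split; [exact: to_avg_lideal_bij | exact: to_avg_lideal_scale].
move=> GamT j.
(* The complement of the whole group is trivial, so [S*H] is [S delta_1]. *)
have H1 (h : subg_of H) : h = 1%g.
  apply: val_inj; have [tiGH _] := complP compl; apply/set1gP; rewrite /= -tiGH.
  by rewrite inE subgP GamT inE.
split.
- exists (fun m : SH => (m : {ffun subg_of H -> _}) 1%g) => [x|m].
    by rewrite ffunE eqxx.
  by apply/ffunP=> h; rewrite ffunE (H1 h) eqxx.
(* Here the acting group is [gT] itself rather than the type [subg_of Gam], hence [id]. *)
- apply: (@auslander_bij _ _ _ _ rG _ id) => // k k1; split; last exact: rG_neq1.
  by have : k \in Gam by [rewrite GamT inE]; rewrite inE => /eqP.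
by move=> a x; apply: skew_op_split_delta.
Qed.
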